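(* Let $\Pi$ be an abstract pattern space over $(X,\Gamma)$ which admits a unique zero element $0$. Let $\Sigma$ be a nonempty subset of $\Pi$ which is atomistic and has the limit inclusion property. Then the local matching topology on $\Sigma$ is metrizable.
   Context: Setting. $X$ is a nonempty proper metric space (closed balls are compact). $\Gamma$ is a group with a left-invariant proper metric $\rho_\Gamma$, and $\Gamma$ is a topological group for the metric topology. $\Gamma$ acts on $X$ by isometries and the action map $\Gamma\times X\to X$ is (jointly) continuous. $\mathrm{Cl}(X)$ is the set of closed subsets of $X$, $\mathrm{Cpt}(X)$ the set of compact subsets of $X$, and $\mathscr{V}$ the set of compact neighborhoods of the identity $e\in\Gamma$. Abstract pattern spaces. An abstract pattern space over $X$ is a nonempty set $\Pi$ with a map (cutting-off operation) $\Pi\times \mathrm{Cl}(X)\to\Pi$, $(\mathcal{P},C)\mapsto\mathcal{P}\wedge C$, such that (1) $(\mathcal{P}\wedge C_1)\wedge C_2=\mathcal{P}\wedge(C_1\cap C_2)$ for all $\mathcal{P}\in\Pi$ and $C_1,C_2\in\mathrm{Cl}(X)$; (2) for every $\mathcal{P}\in\Pi$ there is a (necessarily unique) closed set, denoted $\operatorname{supp}\mathcal{P}$, such that for all $C\in\mathrm{Cl}(X)$: $\mathcal{P}\wedge C=\mathcal{P}\iff C\supset\operatorname{supp}\mathcal{P}$. It is an abstract pattern space over $(X,\Gamma)$ if moreover $\Gamma$ acts on $\Pi$ and $(\gamma\mathcal{P})\wedge(\gamma C)=\gamma(\mathcal{P}\wedge C)$ for all $\mathcal{P}\in\Pi$,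 $C\in\mathrm{Cl}(X)$, $\gamma\in\Gamma$. Elements of $\Pi$ are called abstract patterns. Order. $\mathcal{P}\geq\mathcal{Q}$ means $\mathcal{P}\wedge\operatorname{supp}\mathcal{Q}=\mathcal{Q}$; this is a partial order on $\Pi$. $\bigvee\Xi$ denotes the supremum of $\Xi\subset\Pi$ for this order, when it exists. A zero element is an element with empty support; if it is unique it is denoted $0$. Atoms. An abstract pattern $\mathcal{P}\in\Pi$ is an atom if $\operatorname{supp}\mathcal{P}$ is compact and, for $\mathcal{Q}\in\Pi$, $\mathcal{Q}\leq\mathcal{P}$ implies $\mathcal{Q}=\mathcal{P}$ or $\mathcal{Q}=0$. Put $A(\mathcal{P})=\{\mathcal{Q}\text{ atom}\mid\mathcal{Q}\leq\mathcal{P}\}$. A subset $\Sigma\subset\Pi$ is atomistic if for every $\mathcal{P}\in\Sigma$ the supremum $\bigvee A(\mathcal{P})$ exists and equals $\mathcal{P}$. A subset $\Sigma\subset\Pi$ has the limit inclusion property if for every $\mathcal{P}\in\Sigma$ and every atom $\mathcal{Q}\in\Pi$: if for each $V\in\mathscr{V}$ there is $\gamma_V\in V$ with $\gamma_V\mathcal{Q}\leq\mathcal{P}$, then $\mathcal{Q}\leq\mathcal{P}$. Local matching topology. For $K\in\mathrm{Cpt}(X)$ and $V\in\mathscr{V}$ let $\mathcal{U}_{K,V}=\{(\mathcal{P},\mathcal{Q})\in\Pi\times\Pi\mid\exists\gamma\in V:\ \mathcal{P}\wedge K=(\gamma\mathcal{Q})\wedge K\}$. These sets form a fundamental system of entourages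 of a uniform structure on $\Pi$, the local matching uniform structure; the induced topology is the local matching topology. On a subset $\Sigma\subset\Pi$ one uses the induced (relative) uniform structure and topology. *)

(* Defs.v *)
From HB Require Import structures.
From mathcomp Require Import all_boot all_order all_algebra.
From mathcomp Require Import all_classical all_reals all_analysis.

Set Implicit Arguments.
Unset Strict Implicit.
Unset Printing Implicit Defensive.

Import Order.TTheory GRing.Theory Num.Theory.

Local Open Scope classical_set_scope.
Local Open Scope ring_scope.

HB.mixin Record Metric_isProper (R : realType) M & Metric R M := {
  compact_mdist_ball : forall (x : M) (r : R), compact [set y | mdist x y <= r]
}.

#[short(type="properMetricType")]
HB.structure Definition ProperMetric (R : realType) :=
  { M of Metric R M & Metric_isProper R M }.

HB.mixin Record Group_isMetricGroup (R : realType) G & Metric R G & Group G := {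
  mdist_mulgl : forall g x y : G, mdist (g * x)%g (g * y)%g = mdist x y;
  mulg_continuous : continuous (fun p : G * G => (p.1 * p.2)%g);
  invg_continuous : continuous (fun x : G => (x^-1)%g)
}.

#[short(type="properMetricGroupType")]
HB.structure Definition ProperMetricGroup (R : realType) :=
  { G of ProperMetric R G & Group G & Group_isMetricGroup R G }.

Record isometricAction (R : realType) (G : properMetricGroupType R)
    (X : properMetricType R) := IsometricAction {
  isom_act :> G -> X -> X;
  isom_act1 : forall x, isom_act 1%g x = x;
  isom_actM : forall g h x, isom_act (g * h)%g x = isom_act g (isom_act h x);
  isom_act_mdist : forall g x y,
    mdist (isom_act g x) (isom_act g y) = mdist x y;
  isom_act_continuous : continuous (fun p : G * X => isom_act p.1 p.2)
}.

(* The cutting-off operation is only meaningful on closed sets: it is a total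
   function on [set X] which is unconstrained, and never used, outside of them. *)
Record patternSpace (X : topologicalType) := PatternSpace {
  pattern :> Type;
  cutoff : pattern -> set X -> pattern;
  pattern_nonempty : exists P : pattern, True;
  cutoffI : forall P C1 C2, closed C1 -> closed C2 ->
    cutoff (cutoff P C1) C2 = cutoff P (C1 `&` C2);
  cutoff_supp_ex : forall P, exists2 S, closed S &
    forall C, closed C -> (cutoff P C = P <-> S `<=` C)
}.
Arguments cutoff {X p} P C.

HB.instance Definition _ (X : topologicalType) (Pi : patternSpace X) :=
  gen_eqMixin Pi.
HB.instance Definition _ (X : topologicalType) (Pi : patternSpace X) :=
  gen_choiceMixin Pi.

Section Support.
Context {X : topologicalType} {Pi : patternSpace X}.
Implicit Types (P Q S : Pi) (C : set X).

Definition supp P : set X :=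
  xget set0 [set S | closed S /\
    forall C, closed C -> (cutoff P C = P <-> S `<=` C)].

Lemma suppP P : closed (supp P) /\
  forall C, closed C -> (cutoff P C = P <-> supp P `<=` C).
Proof.
rewrite /supp; case: xgetP => [//|+].
by have [S cS SP] := cutoff_supp_ex P => /(_ S)[].
Qed.

Lemma closed_supp P : closed (supp P). Proof. by have [] := suppP P. Qed.

Lemma cutoff_id P C : closed C -> (cutoff P C = P <-> supp P `<=` C).
Proof. by have [_] := suppP P; apply. Qed.

Lemma cutoff_supp P : cutoff P (supp P) = P.
Proof. by apply/cutoff_id => //; exact: closed_supp. Qed.

Lemma supp_cutoff P C : closed C -> supp (cutoff P C) `<=` supp P `&` C.
Proof.
move=> cC; apply/cutoff_id; first exact: closedI (@closed_supp _) cC.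
have cS := @closed_supp P; have cSC := closedI cS cC.
by rewrite cutoffI// setIC -setIA setIid -cutoffI// cutoff_supp.
Qed.

Definition pattern_le : rel Pi := fun Q P => `[< cutoff P (supp Q) = Q >].

Lemma pattern_le_refl : reflexive pattern_le.
Proof. by move=> P; apply/asboolP; exact: cutoff_supp. Qed.

Lemma pattern_le_supp Q P : pattern_le Q P -> supp Q `<=` supp P.
Proof.
by move=> /asboolP QP; rewrite -{1}QP => x /(supp_cutoff (@closed_supp Q))[].
Qed.

Lemma pattern_le_anti : antisymmetric pattern_le.
Proof.
move=> P Q /andP[PQ QP].
have PQE : supp P = supp Q by apply/seteqP; split; exact: pattern_le_supp.
by move/asboolP: PQ => <-; rewrite PQE cutoff_supp.
Qed.

Lemma pattern_le_trans : transitive pattern_le.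
Proof.
move=> Q S P SQ QP; apply/asboolP.
have /setIidPr SQs := pattern_le_supp SQ.
move/asboolP: SQ => {2}<-; move/asboolP: QP => <-.
by rewrite cutoffI ?SQs//; exact: closed_supp.
Qed.

End Support.

Fact pattern_display : Order.disp_t. Proof. exact: Order.Disp tt tt. Qed.

HB.instance Definition _ (X : topologicalType) (Pi : patternSpace X) :=
  Order.Le_isPOrder.Build pattern_display Pi
    pattern_le_refl pattern_le_anti pattern_le_trans.

Lemma patternleE (X : topologicalType) (Pi : patternSpace X) (P Q : Pi) :
  (Q <= P)%O <-> cutoff P (supp Q) = Q.
Proof. by split=> [/asboolP|QP]; [|apply/asboolP]. Qed.

Definition is_zero (X : topologicalType) (Pi : patternSpace X) (P : Pi) :=
  supp P = set0.

Record equivariantPatternSpace (R : realType) (G : properMetricGroupType R)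
    (X : properMetricType R) (a : isometricAction G X) :=
    EquivariantPatternSpace {
  pattern_base :> patternSpace X;
  pattern_act : G -> pattern_base -> pattern_base;
  pattern_act1 : forall P, pattern_act 1%g P = P;
  pattern_actM : forall g h P,
    pattern_act (g * h)%g P = pattern_act g (pattern_act h P);
  pattern_act_cutoff : forall g P C, closed C ->
    cutoff (pattern_act g P) (a g @` C) = pattern_act g (cutoff P C)
}.
Arguments pattern_act {R G X a e} g P.

Definition compact_nbhs1 (R : realType) (G : properMetricGroupType R)
    (V : set G) :=
  nbhs (1%g : G) V /\ compact V.

Section LocalMatching.
Context {R : realType} {G : properMetricGroupType R} {X : properMetricType R}.
Context {a : isometricAction G X} {Pi : equivariantPatternSpace a}.
Implicit Types (P Q : Pi) (C K : set X) (V : set G) (g : G).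
Local Open Scope relation_scope.

Definition local_match K V : set (Pi * Pi) :=
  [set PQ | exists2 g, V g & cutoff PQ.1 K = cutoff (pattern_act g PQ.2) K].

Definition local_entourage : set_system (Pi * Pi) :=
  filter_from [set KV : set X * set G | compact KV.1 /\ compact_nbhs1 KV.2]
              (fun KV => local_match KV.1 KV.2).

Lemma compact_nbhs1_subset (A : set G) : nbhs (1%g : G) A ->
  exists2 V, compact_nbhs1 V & V `<=` A.
Proof.
move=> /nbhs_ballP[r /= r0 rA].
exists [set y | mdist (1%g : G) y <= r / 2].
  split; last exact: compact_mdist_ball.
  apply/nbhs_ballP; exists (r / 2) => /=; first by rewrite divr_gt0.
  by rewrite ballEmdist => y /= /ltW.
move=> y /= yr; apply: rA; rewrite ballEmdist/=; apply: le_lt_trans yr _.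
by rewrite ltr_pdivrMr// ltr_pMr// ltr1n.
Qed.

Lemma compact_closedX K : compact K -> closed K.
Proof. by apply: compact_closed; exact: (@metric_hausdorff R). Qed.

Lemma compact_act V K : compact V -> compact K ->
  compact [set a g x | g in V & x in K].
Proof.
move=> cV cK; have -> : [set a g x | g in V & x in K] =
    (fun p : G * X => a p.1 p.2) @` (V `*` K).
  apply/seteqP; split => [_ [g Vg [x Kx <-]]|_ [[g x] [/= Vg Kx] <-]].
    by exists (g, x).
  by exists g => //; exists x.
apply: continuous_compact; last exact: compact_setX.
by apply: continuous_subspaceT; exact: isom_act_continuous.
Qed.

Lemma closed_act g C : closed C -> closed (a g @` C).
Proof.
move=> cC; have -> : a g @` C = a (g^-1)%g @^-1` C.
  apply/seteqP; split => [_ [x Cx <-]|x /= Cx].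
    by rewrite /preimage/= -isom_actM mulVg isom_act1.
  by exists (a (g^-1)%g x) => //; rewrite -isom_actM mulgV isom_act1.
have /continuous_closedP : continuous (a (g^-1)%g); last exact.
move=> x; apply: (@continuous_comp X (G * X)%type X
  (fun x => (g^-1, x)%g) (fun p => a p.1 p.2)).
  by apply: cvg_pair => //; exact: cvg_cst.
exact: (@isom_act_continuous R G X a).
Qed.

Lemma cutoff_sub P Q C K : closed C -> closed K -> K `<=` C ->
  cutoff P C = cutoff Q C -> cutoff P K = cutoff Q K.
Proof. by move=> cC cK /setIidPr <- PQ; rewrite -!cutoffI// PQ. Qed.

Let local_filter : Filter local_entourage.
Proof.
apply: filter_from_filter.
  have [V V1 _] := @compact_nbhs1_subset setT filterT.
  by exists (set0, V); split => //; exact: compact0.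
move=> [K V] [K' V'] [/= cK [V1 cV]] [/= cK' [V1' cV']].
have cU : compact (K `|` K') by exact: compactU.
have [W W1 WV] := @compact_nbhs1_subset (V `&` V') (filterI V1 V1').
exists (K `|` K', W) => //= -[P Q] [/= g /WV[Vg Vg'] PQ].
split; exists g => //=; apply: cutoff_sub PQ; try exact: compact_closedX.
  exact: subsetUl.
exact: subsetUr.
Qed.

Let local_diagonal A : local_entourage A -> diagonal `<=` A.
Proof.
move=> [[K V] [/= _ [V1 _]] KVA] [P Q] /diagonalP ->; apply: KVA => /=.
by exists 1%g; [exact: nbhs_singleton|rewrite pattern_act1].
Qed.

Lemma cutoff_actV g P Q K : closed K ->
  cutoff P (a g @` K) = cutoff (pattern_act g Q) (a g @` K) ->
  cutoff Q K = cutoff (pattern_act (g^-1)%g P) K.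
Proof.
move=> cK PQ.
have gK C : a (g^-1)%g @` (a g @` C) = C.
  rewrite image_comp -[RHS]image_id; apply: eq_imagel => x _ /=.
  by rewrite -isom_actM mulVg isom_act1.
rewrite -[in RHS](gK K) pattern_act_cutoff; last exact: closed_act.
by rewrite PQ pattern_act_cutoff// -pattern_actM mulVg pattern_act1.
Qed.

Let local_inv A : local_entourage A -> local_entourage A^-1.
Proof.
move=> [[K V] [/= cK [V1 cV]] KVA].
have [W [W1 cW] WV] : exists2 W, compact_nbhs1 W &
    W `<=` [set g | V (g^-1)%g].
  apply: compact_nbhs1_subset; apply: (@invg_continuous R G 1%g).
  by rewrite invg1.
have cWK := compact_act cW cK.
exists ([set a g x | g in W & x in K], W) => //= -[P Q] [/= g Wg PQ].
apply: KVA; exists (g^-1)%g; first exact: WV.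
apply: cutoff_actV; first exact: compact_closedX.
apply: cutoff_sub PQ; [exact: compact_closedX| |].
- by apply: closed_act; exact: compact_closedX.
- by move=> _ [x Kx <-]; exists g => //; exists x.
Qed.

Let local_split A : local_entourage A ->
  exists2 B, local_entourage B & B \; B `<=` A.
Proof.
move=> [[K V] [/= cK [V1 cV]] KVA].
have [W [W1 cW] WV] : exists2 W, compact_nbhs1 W &
    W `<=` [set g | V (g^-1)%g] `&` [set g | forall h, W h -> V (g * h)%g].
  have := @mulg_continuous R G (1%g, 1%g) V; rewrite /= mulg1 => /(_ V1).
  case=> -[A1 A2] [/= A11 A21] AV.
  have invV : nbhs (1%g : G) [set g | V (g^-1)%g].
    by apply: (@invg_continuous R G 1%g); rewrite invg1.
  have [W W1 WA] :=
    compact_nbhs1_subset (filterI invV (filterI A11 A21)).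
  exists W => // g Wg; have [Vg [A1g _]] := WA _ Wg.
  by split => // h /WA[_ [_ A2h]]; exact: (AV (g, h)).
have cWi : compact ((fun g : G => (g^-1)%g) @` W).
  apply: continuous_compact => //.
  by apply: continuous_subspaceT; exact: invg_continuous.
set L := K `|` [set a g x | g in (fun g : G => (g^-1)%g) @` W & x in K].
have cL : compact L by apply: compactU => //; exact: compact_act.
exists (local_match L W); first by exists (L, W).
move=> [P S] [Q [/= g Wg PQ] [/= h Wh QS]]; apply: KVA => /=.
have clL := compact_closedX cL; have clK := compact_closedX cK.
exists (g * h)%g; first by have [_] := WV _ Wg; apply.
have -> : cutoff P K = cutoff (pattern_act g Q) K.
  by apply: cutoff_sub PQ => // x; left.
have gK : a g @` (a (g^-1)%g @` K) = K.
  rewrite image_comp -[RHS]image_id; apply: eq_imagel => x _ /=.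
  by rewrite -isom_actM mulgV isom_act1.
have clgK := @closed_act (g^-1)%g K clK.
rewrite pattern_actM -gK !pattern_act_cutoff//; congr pattern_act.
apply: cutoff_sub QS => // _ [x Kx <-]; right.
by exists (g^-1)%g; [exists g|exists x].
Qed.

(* The local matching uniform structure; the local matching topology is the
   topology that comes with it. *)
HB.instance Definition _ := isUniform.Build (pattern (pattern_base Pi))
  local_filter local_diagonal local_inv local_split.

Lemma local_entourageE : @entourage Pi = local_entourage.
Proof. by []. Qed.

Definition atom (zero P : Pi) :=
  compact (supp P) /\ forall Q, (Q <= P)%O -> Q = P \/ Q = zero.

Definition atoms_below (zero P : Pi) : set Pi :=
  [set Q | atom zero Q /\ (Q <= P)%O].

Definition atomistic (zero : Pi) (Sigma : set Pi) :=
  forall P, Sigma P -> supremums (atoms_below zero P) P.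

Definition limit_inclusion (zero : Pi) (Sigma : set Pi) :=
  forall P Q, Sigma P -> atom zero Q ->
    (forall V, compact_nbhs1 V ->
       exists2 g, V g & (pattern_act g Q <= P)%O) ->
    (Q <= P)%O.

End LocalMatching.

Definition metrizable (R : realType) (T : topologicalType) :=
  exists d : T -> T -> R,
    [/\ forall x y, d x y = 0 <-> x = y,
        forall x y, d x y = d y x,
        forall x y z, d x z <= d x y + d y z &
        forall x, nbhs x =
          filter_from [set r | 0 < r] (fun r => [set y | d x y < r])].

(* Main.v *)
(* The entourages [local_match] of closed balls of integer radius in X and
   closed balls of radius 1/(n+1) in G form a countable base, so the local
   matching uniformity is pseudometrizable, and it remains to see that it
   separates the points of Sigma. If P and Q are indistinguishable and S is an
   atom below P, matching P and Q on the compact set supp S shows that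
   arbitrarily small translates of S lie below Q, hence S <= Q by limit
   inclusion. By atomisticity P <= Q, and P = Q by symmetry. *)
Require Import Defs.
From mathcomp Require Import all_boot all_order all_algebra.
From mathcomp Require Import all_classical all_reals all_analysis.

Set Implicit Arguments.
Unset Strict Implicit.
Unset Printing Implicit Defensive.

Import Order.TTheory GRing.Theory Num.Theory.

Local Open Scope classical_set_scope.
Local Open Scope ring_scope.

(** The entourages of the initial uniformity are generated by pullbacks along [f], so a countable
    base pulls back to one. Applied to the inclusion of [Sigma]. *)
Lemma countable_uniformity_initial (S : choiceType) (U : uniformType)
    (f : S -> U) :
  countable_uniformity U -> countable_uniformity (initial_topology f).
Proof.
move=> /countable_uniformityP[g gU entg]; apply/countable_uniformityP.
exists (fun n => (fun xy => (f xy.1, f xy.2)) @^-1` g n);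
  last by move=> n; exists (g n).
move=> A [B /gU[n gB] BA]; exists n; apply: subset_trans BA => xy.
exact: gB.
Qed.

Lemma countable_uniformity_metrizable (R : realType) (T : uniformType) :
  countable_uniformity T ->
  (forall x y : T, (forall A, entourage A -> A (x, y)) -> x = y) ->
  metrizable R T.
Proof.
move=> cT sepT; pose M : pseudoMetricType R := countable_uniform cT.
have fin (x y : M) : edist (x, y) \is a fin_num.
  (* In the pseudometric built from a countable base, any two points lie within a ball of radius
     2. *)
  apply/edist_finP; exists 2 => //.
  exact: countable_uniform.countable_uniform_bounded.
exists (fun x y : M => fine (edist (x, y))); split.
- move=> x y; split => [d0|->].
    apply: sepT; rewrite -(@entourage_close M).
    by apply/(@edist_closeP R M); rewrite -[LHS]fineK// d0.
  by have /(@edist_closeP R M) -> := @close_refl M y.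
- by move=> x y; rewrite edist_sym.
- by move=> x y z; rewrite -lee_fin EFinD !fineK//; exact: edist_triangle.
- move=> x; apply/seteqP; split => A.
    move=> /(@nbhs_ballP R M)[r /= r0 rA]; exists r => //= y.
    rewrite /mkset -lte_fin fineK// => xy.
    exact/rA/(@edist_lt_ball R M r (x, y)).
  move=> [r /= r0 rA]; apply/(@nbhs_ballP R M).
  (* Membership in a ball only bounds [edist] non-strictly; halving the radius restores
     strictness. *)
  exists (r / 2) => /=; first by rewrite divr_gt0.
  move=> y xy; apply: rA => /=; rewrite -lte_fin fineK//.
  apply: (@le_lt_trans _ _ (r / 2)%:E).
    by apply: (@edist_fin R M _ (x, y)); rewrite ?divr_gt0.
  by rewrite lte_fin ltr_pdivrMr// ltr_pMr// ltr1n.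
Qed.

(** On the unit ball around [y] the distance to [x] is at most [mdist x y + 1]; compactness makes
    the choice of [n] uniform in [y]. *)
Lemma compact_mdist_bounded (R : realType) (X : metricType R) (x : X)
    (K : set X) : compact K ->
  \forall n \near \oo, K `<=` [set y | mdist x y <= n%:R].
Proof.
move=> /compact_near_coveringP; apply => y _.
near=> z n => /=; apply: (@le_trans _ _ (mdist x y + 1)).
  rewrite (le_trans (metric_triangle _ y _))// lerD2l ltW//.
  by near: z; have := @nbhsx_ballx R X y 1 ltr01; rewrite ballEmdist.
by near: n; exact: nbhs_infty_ger.
Unshelve. all: by end_near. Qed.

(** Since [supp Q] lies in [C], cutting [P] at [C] first does not change its cut at [supp Q]. *)
Lemma cutoff_pattern_le (X : topologicalType) (Pi : patternSpace X)
    (P Q : Pi) C : closed C -> cutoff P C = Q -> (Q <= P)%O.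
Proof.
move=> cC PQ; apply/patternleE.
have /setIidPr QC : supp Q `<=` C.
  by rewrite -PQ => x /(supp_cutoff cC)[].
by rewrite -QC -cutoffI ?PQ ?cutoff_supp//; exact: closed_supp.
Qed.

Section LocalMatching.
Context {R : realType} {G : properMetricGroupType R} {X : properMetricType R}.
Context {a : isometricAction G X} {Pi : equivariantPatternSpace a}.
Implicit Types (P Q S : Pi) (K L : set X) (V W : set G).

Lemma local_match_sub K L V W : closed K -> closed L -> L `<=` K -> V `<=` W ->
  @local_match R G X a Pi K V `<=` local_match L W.
Proof.
move=> cK cL LK VW [P Q] [/= g /VW Wg PQ]; exists g => //=.
exact: cutoff_sub PQ.
Qed.

Lemma countable_uniformity_local : [set: X] !=set0 -> countable_uniformity Pi.
Proof.
move=> [x _]; apply/countable_uniformityP.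
exists (fun n => local_match [set y | mdist x y <= n%:R]
                   [set g : G | mdist 1%g g <= n.+1%:R^-1]).
  move=> A [[K V] [/= cK [V1 cV]] KVA].
  have /nbhs_ballP[r /= r0 rV] := V1.
  near \oo => n.
  exists n; apply: subset_trans KVA; apply: local_match_sub.
  - by apply: compact_closedX; exact: compact_mdist_ball.
  - exact: compact_closedX.
  - by near: n; exact: compact_mdist_bounded.
  - move=> g /= gn; apply: rV; rewrite ballEmdist/=; apply: le_lt_trans gn _.
    by near: n; exact: (near_infty_natSinv_lt (PosNum r0)).
move=> n; exists ([set y | mdist x y <= n%:R],
                  [set g : G | mdist 1%g g <= n.+1%:R^-1]) => //=.
split; first exact: compact_mdist_ball.
split; last exact: compact_mdist_ball.
apply/nbhs_ballP; exists n.+1%:R^-1 => //=.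
by rewrite ballEmdist => y /= /ltW.
Unshelve. all: by end_near. Qed.

Lemma pattern_actK g : cancel (pattern_act g) (pattern_act g^-1%g : Pi -> Pi).
Proof. by move=> P; rewrite -pattern_actM mulVg pattern_act1. Qed.

Lemma pattern_act_le g P Q :
  (P <= Q)%O -> (pattern_act g P <= pattern_act g Q)%O.
Proof.
move=> /patternleE PQ; have cP := @closed_supp _ _ P.
(* Cutting at the translated support avoids computing the support of [pattern_act g P]. *)
apply: (@cutoff_pattern_le _ _ _ _ (a g @` supp P)); first exact: closed_act.
by rewrite pattern_act_cutoff// PQ.
Qed.

Lemma local_entourage_atom_le (zero : Pi) (Sigma : set Pi) P Q S :
  limit_inclusion zero Sigma -> Sigma Q ->
  (forall A, entourage A -> A (P, Q)) ->
  atom zero S -> (S <= P)%O -> (S <= Q)%O.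
Proof.
move=> limS SQ PQ aS SP; apply: (limS) => // V [V1 _].
have cS : compact (supp S) by case: aS.
(* Matching will move [Q] by some [g], whereas limit inclusion moves [S], hence by [g^-1], which
   must lie in [V]. *)
have [W W1 WV] : exists2 W, compact_nbhs1 W & W `<=` [set g | V (g^-1)%g].
  apply: compact_nbhs1_subset; apply: (@invg_continuous R G 1%g).
  by rewrite invg1.
have [|g /= Wg PgQ] := PQ (local_match (supp S) W).
  by exists (supp S, W).
exists (g^-1)%g; first exact: WV.
rewrite -(pattern_actK g Q); apply: pattern_act_le; apply/patternleE.
by rewrite -PgQ; apply/patternleE.
Qed.

Lemma local_entourage_eq (zero : Pi) (Sigma : set Pi) P Q :
  atomistic zero Sigma -> limit_inclusion zero Sigma -> Sigma P -> Sigma Q ->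
  (forall A, entourage A -> A (P, Q)) -> P = Q.
Proof.
move=> atS limS SP SQ PQ; have QP A : entourage A -> A (Q, P).
  by move=> /entourage_inv /PQ.
apply: le_anti; apply/andP; split.
  (* [P] is the least upper bound of its atoms, so it suffices that [Q] bounds them. *)
  have [_] := atS _ SP; apply => S [aS SleP].
  exact: (local_entourage_atom_le limS SQ PQ aS SleP).
have [_] := atS _ SQ; apply => S [aS SleQ].
exact: (local_entourage_atom_le limS SP QP aS SleQ).
Qed.

End LocalMatching.

Local Close Scope ring_scope.

Theorem corollary3p8 (R : realType) (G : properMetricGroupType R)
    (X : properMetricType R) (a : isometricAction G X)
    (Pi : equivariantPatternSpace a) (zero : Pi) (Sigma : set Pi) :
  [set: X] !=set0 ->
  unique (@is_zero X Pi) zero ->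
  Sigma !=set0 ->
  atomistic zero Sigma ->
  limit_inclusion zero Sigma ->
  metrizable R (set_type Sigma).
Proof.
move=> X0 _ _ atS limS.
apply: (@countable_uniformity_metrizable R (set_type Sigma)).
  exact/countable_uniformity_initial/countable_uniformity_local.
move=> x y xy; apply: val_inj.
apply: (local_entourage_eq atS limS) => [||A entA]; try exact: set_valP.
(* The trace of [A] on [Sigma] is an entourage of the induced uniformity. *)
by apply: (xy ((fun xy => (set_val xy.1, set_val xy.2)) @^-1` A)); exists A.
Qed.
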